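(* Let $G$ be a compactly generated locally compact group of polynomial growth and let $1<p<\infty$. Let $u:G\to\,]0,+\infty[$ be a measurable submultiplicative function with $u(x)=u(x^{-1})$ for all $x\in G$, and let $w_1$ be a weight on $G$ satisfying (LPAlg). Then the function $w(x)=u(x)w_1(x)$ also satisfies (LPAlg).
   Context: $G$ is of polynomial growth if there are a relatively compact neighbourhood $U$ of the identity with $G=\bigcup_nU^n$ and constants $C,Q$ with $|U^n|\le Cn^Q$ for all $n\ge1$, where $|\cdot|$ is Haar measure. Let $\frac1p+\frac1q=1$. A function $u$ is submultiplicative if $u(xy)\le u(x)u(y)$ for all $x,y\in G$. A weight $\omega$ on $G$ satisfies (LPAlg) if $\omega:G\to[1,+\infty[$ is measurable and $\omega(xy)\le\omega(x)\omega(y)$, $\omega(x^{-1})=\omega(x)$ for all $x,y\in G$, and $\omega^{-q}*\omega^{-q}\le\omega^{-q}$ pointwise, where $(f*g)(x)=\int_Gf(y)g(y^{-1}x)\,dy$. *)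

(* Defs.v *)
From HB Require Import structures.
From mathcomp Require Import all_boot all_order all_algebra.
From mathcomp Require Import all_classical all_reals all_analysis.

Set Implicit Arguments.
Unset Strict Implicit.
Unset Printing Implicit Defensive.

Import Order.TTheory GRing.Theory Num.Theory.
Import numFieldNormedType.Exports.

Local Open Scope classical_set_scope.
Local Open Scope ring_scope.

(* A multiplicative, not necessarily commutative, counterpart of
   [topologicalZmodType]; separation is not part of the structure. *)
HB.mixin Record isTopologicalGroup G & Topological G & Group G := {
  mulg_continuous : continuous (fun x : G * G => (x.1 * x.2)%g) ;
  invg_continuous : continuous (fun x : G => (x^-1)%g)
}.

#[short(type="topologicalGroupType")]
HB.structure Definition TopologicalGroup :=
  {G of Topological G & Group G & isTopologicalGroup G}.

Section Borel.
Variable G : topologicalGroupType.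

(* Measurable types are pointed; the alias takes the unit as its point. *)
Definition pointed_group : Type := G.
HB.instance Definition _ := Topological.on pointed_group.
HB.instance Definition _ := isPointed.Build pointed_group (1%g : G).

(* [G] with its Borel sigma-algebra. *)
Definition borel : Type := g_sigma_algebraType (@open pointed_group).
HB.instance Definition _ := Measurable.on borel.

End Borel.

Section Groups.
Variable G : topologicalGroupType.

Definition set_expg (U : set G) (n : nat) : set G :=
  iter n (fun A => [set (x * y)%g | x in U & y in A]) [set 1%g].

Definition compactly_generated : Prop :=
  exists2 K : set G, compact K &
    smallest (fun H : set G => group_closed (mem H)) K = [set: G].

Variable R : realType.
Variable mu : {measure set (borel G) -> \bar R}.

(* Left Haar measure: a nonzero left-invariant Radon measure on the Borel
   sets. *)
Record haar_measure : Prop := HaarMeasure {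
  haar_neq0 : mu [set: G] != 0%E ;
  haar_compact : forall K : set G, compact K -> (mu K < +oo)%E ;
  haar_outer_regular : forall A : set G, measurable (A : set (borel G)) ->
    mu A = ereal_inf [set mu V | V in [set V : set G | open V /\ A `<=` V]] ;
  haar_inner_regular : forall V : set G, open V ->
    mu V = ereal_sup [set mu K | K in [set K : set G | compact K /\ K `<=` V]] ;
  haar_left_invariant : forall (x : G) (A : set G),
    measurable (A : set (borel G)) -> mu [set (x * y)%g | y in A] = mu A
}.

(* [U] need not be Borel, and its powers need not be even if [U] is; the outer
   measure [mu_ext mu] agrees with [mu] on Borel sets, and with the completion of
   [mu] on the sets measurable for it. *)
Definition polynomial_growth : Prop :=
  exists U : set G, [/\ nbhs 1%g U, precompact U,
    \bigcup_n set_expg U n = [set: G] &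
    exists C Q : R, forall n : nat, (0 < n)%N ->
      (mu_ext mu (set_expg U n) <= (C * n%:R `^ Q)%:E)%E].

Definition convolution (f g : G -> R) (x : G) : \bar R :=
  (\int[mu]_(y in [set: borel G]) (f y * g ((y : G)^-1 * x)%g)%:E)%E.

Definition submultiplicative (u : G -> R) : Prop :=
  forall x y : G, u (x * y)%g <= u x * u y.

Definition symmetric_fun (u : G -> R) : Prop :=
  forall x : G, u (x^-1)%g = u x.

Record LPAlg (q : R) (w : G -> R) : Prop := MkLPAlg {
  LPAlg_ge1 : forall x : G, 1 <= w x ;
  LPAlg_measurable : measurable_fun [set: borel G] (w : borel G -> R) ;
  LPAlg_submult : submultiplicative w ;
  LPAlg_sym : symmetric_fun w ;
  LPAlg_conv : forall x : G,
    (convolution (fun y => (w y `^ (- q))%R) (fun y => (w y `^ (- q))%R) x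
      <= (w x `^ (- q))%:E)%E
}.

End Groups.

(* Main.v *)
Require Import Defs.
From HB Require Import structures.
From mathcomp Require Import all_boot all_order all_algebra.
From mathcomp Require Import all_classical all_reals all_analysis.
From mathcomp Require Import measurable_realfun.

Import Order.TTheory GRing.Theory Num.Theory.
Import numFieldNormedType.Exports.

Local Open Scope classical_set_scope.
Local Open Scope ring_scope.

(** Since [q > 0], submultiplicativity of [u] along [x = y * (y^-1 * x)] bounds
    [u(y)^-q * u(y^-1 x)^-q] by [u(x)^-q], which does not depend on [y] and so
    factors out of the convolution integral. *)

(** From [u 1 <= u 1 * u 1] and positivity, [1 <= u 1]; then [1 <= u 1 <= u x * u x^-1 = u x ^ 2] by
    symmetry, and squares of nonnegative numbers compare like the numbers. *)
Lemma submultiplicative_sym_ge1 (R : realType) (G : topologicalGroupType)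
  (u : G -> R) :
  (forall x, 0 < u x) -> submultiplicative u -> (forall x, u x = u (x^-1)%g) ->
  forall x, 1 <= u x.
Proof.
move=> u_gt0 uM uV x.
have u1 : 1 <= u 1%g.
  by rewrite -(ler_pM2l (u_gt0 1%g)) mulr1 -{1}[1%g]mul1g; exact: uM.
rewrite -(@ler_pXn2r _ 2) ?nnegrE ?ler01 ?(ltW (u_gt0 x))// expr1n expr2 {2}(uV x).
by apply: (le_trans u1); rewrite -(mulgV x); exact: uM.
Qed.

Lemma continuous_borel_measurable (G : topologicalGroupType) (f : G -> G) :
  continuous f -> measurable_fun [set: borel G] (f : borel G -> borel G).
Proof.
move=> /continuousP cf.
apply: (@measurability _ _ (borel G) (borel G) _ _ (@open (pointed_group G))).
  by [].
by move=> _ [B oB <-]; rewrite setTI; apply: sub_sigma_algebra; exact: cf.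
Qed.

(** Serves the measurability of the convolution integrand. Fixing [x] keeps the map in one variable,
    hence Borel by continuity; on [G * G] the Borel sets may exceed the product sigma-algebra. *)
Lemma continuous_invg_mulg (G : topologicalGroupType) (x : G) :
  continuous (fun y : G => (y^-1 * x)%g).
Proof.
move=> y.
have yx : ((z^-1)%g, x) @[z --> y] --> nbhs (((y^-1)%g, x) : G * G).
  apply: (@cvg_pair _ _ _ _ (nbhs (y^-1)%g) (nbhs x)).
    exact: invg_continuous.
  exact: cvg_cst.
exact: cvg_comp yx (@mulg_continuous G ((y^-1)%g, x)).
Qed.

Theorem mainTheorem8 (R : realType) (G : topologicalGroupType)
  (mu : {measure set (borel G) -> \bar R}) (p q : R) (u w1 : G -> R)
  (hausdorffG : hausdorff_space G)
  (lcompactG : locally_compact [set: G])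
  (cgenG : compactly_generated G)
  (haar_mu : haar_measure mu)
  (growthG : polynomial_growth mu)
  (p_gt1 : 1 < p)
  (conj_pq : p^-1 + q^-1 = 1)
  (u_gt0 : forall x : G, 0 < u x)
  (u_meas : measurable_fun [set: borel G] (u : borel G -> R))
  (u_submult : submultiplicative u)
  (u_sym : forall x : G, u x = u (x^-1)%g)
  (w1_LPAlg : LPAlg mu q w1) :
  LPAlg mu q (fun x : G => u x * w1 x).
Proof.
have q_gt0 : 0 < q.
  (* The sign is read off from [q^-1 = 1 - p^-1 > 0]; with the convention [0^-1 = 0] this also
     excludes [q = 0]. *)
  rewrite -invr_gt0 -(addKr p^-1 q^-1) conj_pq addrC subr_gt0.
  by rewrite invf_lt1 ?(lt_trans ltr01).
have [w1_ge1 w1_meas w1_submult w1_sym w1_conv] := w1_LPAlg.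
have u_ge1 := submultiplicative_sym_ge1 _ _ u u_gt0 u_submult u_sym.
have w1_gt0 x : 0 < w1 x by exact: lt_le_trans (w1_ge1 x).
have u_ge0 x : 0 <= u x by exact: ltW.
have w1_ge0 x : 0 <= w1 x by exact: ltW.
have powN_meas (v : G -> R) :
    measurable_fun [set: borel G] (v : borel G -> R) ->
    measurable_fun [set: borel G] (fun y : borel G => v y `^ (- q)).
  exact: (@measurableT_comp _ _ _ _ _ _ (@powR R ^~ (- q))).
have shift_meas (v : G -> R) (x : G) :
    measurable_fun [set: borel G] (v : borel G -> R) ->
    measurable_fun [set: borel G] (fun y : borel G => v ((y : G)^-1 * x)%g).
  move=> mv; apply: (measurableT_comp mv).
  exact: (continuous_borel_measurable _ _ (continuous_invg_mulg G x)).
have conv_meas (v : G -> R) (x : G) :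
    measurable_fun [set: borel G] (v : borel G -> R) ->
    measurable_fun [set: borel G]
      (fun y : borel G => v y `^ (- q) * v ((y : G)^-1 * x)%g `^ (- q)).
  move=> mv; apply: measurable_funM; first exact: powN_meas.
  exact: shift_meas (fun z => v z `^ (- q)) x (powN_meas _ mv).
have w_meas : measurable_fun [set: borel G] (fun x : borel G => u x * w1 x).
  exact: measurable_funM.
split => //.
- by move=> x; rewrite mulr_ege1.
- by move=> x y; rewrite mulrACA ler_pM.
- by move=> x; rewrite -u_sym w1_sym.
move=> x; rewrite /convolution powRM// EFinM.
(* The middle term separates the two hypotheses: a pointwise bound on integrands using [u_submult]
   leads to it, and [w1_conv] scaled by a nonnegative constant leads from it. *)
apply: (@le_trans _ _ ((u x `^ (- q))%:E *
  convolution mu (fun y => (w1 y `^ (- q))%R) (fun y => (w1 y `^ (- q))%R) x)%E).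
  rewrite /convolution -ge0_integralZl//; last 3 first.
  - apply/measurable_EFinP; exact: conv_meas.
  - by move=> y _; rewrite lee_fin mulr_ge0// powR_ge0.
  - by rewrite lee_fin powR_ge0.
  apply: ge0_le_integral => //.
  - by move=> y _; rewrite lee_fin mulr_ge0// powR_ge0.
  - apply/measurable_EFinP; exact: conv_meas w_meas.
  - apply: measurable_funeM; apply/measurable_EFinP; exact: conv_meas.
  (* Regrouping puts the same [w1] factors on both sides, so that only the powers of [u] remain to
     be compared. *)
  move=> y _; rewrite -EFinM lee_fin !powRM// mulrACA.
  rewrite ler_wpM2r ?mulr_ge0 ?powR_ge0//.
  (* The negative exponent reverses the order: what is left is [u x <= u y * u (y^-1 * x)], raised
     to the power [q > 0]. *)
  rewrite -powRM// !powRN lef_pV2 ?posrE ?powR_gt0 ?mulr_gt0//.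
  rewrite ge0_ler_powR ?nnegrE ?mulr_ge0 ?(ltW q_gt0)//.
  by rewrite -{1}(mulVKg y x); exact: u_submult.
by rewrite lee_wpmul2l// lee_fin powR_ge0.
Qed.
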